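(* Let $K$ be a complete multipartite graph and $k\ge 1$ an integer. Then for every $n$ there is an $n$-vertex complete $r$-partite graph $T$ for some $r\ge k$ such that $\mathrm{ex}_{\mathrm{re}}(n,K,K_{k+1})=\mathcal{N}_{\mathrm{re}}(K,K_{k+1},T)$.
   Context: All graphs are finite and simple. A copy of a graph $H$ in a graph $G$ is a (not necessarily induced) subgraph of $G$ isomorphic to $H$. Two subgraphs $G'$ and $G''$ of $G$ align in $G$ if $V(G')\subseteq V(G'')$ or $V(G'')\subseteq V(G')$. $\mathcal{N}_{\mathrm{re}}(H,F,G)$ denotes the number of copies of $H$ in $G$ that do not align with any copy of $F$ in $G$, and $\mathrm{ex}_{\mathrm{re}}(n,H,F)$ is the maximum of $\mathcal{N}_{\mathrm{re}}(H,F,G)$ over all $n$-vertex graphs $G$. *)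

(* Defs.v *)
From HB Require Import structures.
From mathcomp Require Import all_boot.

Set Implicit Arguments.
Unset Strict Implicit.
Unset Printing Implicit Defensive.

(* Simple graphs with vertex set V, given by their set of edges, an edge being
   a two-element set of vertices. *)
Record sgraph (V : finType) := SGraph {
  edges : {set {set V}};
  edges_card2 : [forall e in edges, #|e| == 2] }.

HB.instance Definition _ (V : finType) := [isSub for @edges V].
HB.instance Definition _ (V : finType) := [Finite of sgraph V by <:].

Definition adj (V : finType) (G : sgraph V) : rel V :=
  fun x y => [set x; y] \in edges G.

Fact complete_graph_subproof (n : nat) :
  [forall e in [set e : {set 'I_n} | #|e| == 2], #|e| == 2].
Proof. by apply/forall_inP => e; rewrite inE. Qed.

Definition complete_graph (n : nat) : sgraph 'I_n :=
  SGraph (complete_graph_subproof n).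

(* The fibres of c are the parts; some of them may be empty, unless c is
   surjective. *)
Definition complete_partite (V : finType) (G : sgraph V) (r : nat)
    (c : V -> 'I_r) : Prop :=
  forall x y : V, adj G x y = (c x != c y).

(* Discarding empty parts does not change the graph, so there is no need to
   forbid them here. *)
Definition complete_multipartite (V : finType) (G : sgraph V) : Prop :=
  exists (r : nat) (c : V -> 'I_r), complete_partite G c.

(* A pair (S, E) stands for the graph with vertex set S and edge set E. *)
Definition is_subgraph (V : finType) (G : sgraph V)
    (P : {set V} * {set {set V}}) : bool :=
  (P.2 \subset edges G) && [forall e in P.2, e \subset P.1].

Definition is_isomorphic (V W : finType) (H : sgraph W)
    (P : {set V} * {set {set V}}) : bool :=
  [exists f : {ffun W -> V},
    [&& injectiveb f,
        f @: [set: W] == P.1 &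
        [set f @: (e : {set W}) | e in edges H] == P.2]].

Definition copies (V W : finType) (H : sgraph W) (G : sgraph V) :
    {set {set V} * {set {set V}}} :=
  [set P | is_subgraph G P && is_isomorphic H P].

Definition align (V : finType) (P Q : {set V} * {set {set V}}) : bool :=
  (P.1 \subset Q.1) || (Q.1 \subset P.1).

Definition N_re (V W U : finType) (H : sgraph W) (F : sgraph U)
    (G : sgraph V) : nat :=
  #|[set P in copies H G | ~~ [exists Q in copies F G, align P Q]]|.

Definition ex_re (n : nat) (W U : finType) (H : sgraph W) (F : sgraph U) :
    nat :=
  \max_(G : sgraph 'I_n) N_re H F G.

(* Main.v *)
(* Zykov symmetrization.  Call a copy of K good if it aligns with no K_{k+1}.  If
   u and v are nonadjacent, turning u into a twin of v keeps every good copy of K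
   avoiding u, and also every good copy containing both: K being complete
   multipartite, u and v are then twins inside the copy.  The copies containing u
   but not v get replaced by mirror images of those containing v but not u.
   Hence an extremal graph remains extremal under each such step, in both
   directions.  Moving a vertex into a twin class at least as large as its own
   increases the number of pairs of twins, so an extremal graph with the most such
   pairs is complete multipartite.  If it has fewer than k parts, splitting parts
   until there are k of them adds edges without creating a K_{k+1}. *)
Require Import Defs.
From mathcomp Require Import all_boot zify.

Set Implicit Arguments.
Unset Strict Implicit.
Unset Printing Implicit Defensive.

(** * Graphs from relations, and cliques under homomorphisms *)

Section Basics.
Variable V : finType.
Implicit Types (G : sgraph V) (S C : {set V}) (x y : V).

Lemma edge_card2 G (e : {set V}) : e \in edges G -> #|e| = 2.
Proof. by move=> eG; apply/eqP; exact: (forall_inP (edges_card2 G)). Qed.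

Lemma edgeP G (e : {set V}) :
  reflect (exists x y, e = [set x; y] /\ adj G x y) (e \in edges G).
Proof.
apply: (iffP idP) => [eG|[x [y [->]]]] //.
have /eqP/cards2P[x [y [_ def_e]]] := edge_card2 eG.
by exists x, y; rewrite /adj -def_e.
Qed.

Lemma adj_sym G : symmetric (adj G).
Proof. by move=> x y; rewrite /adj setUC. Qed.

Lemma adj_irr G : irreflexive (adj G).
Proof.
by move=> x; apply/negP => /edge_card2; rewrite setUid cards1.
Qed.

(** Both orders of a pair are tested, so an edge requires [e] in both directions; the guard [x != y]
    ignores the diagonal. *)
Fact rel_graph_subproof (e : rel V) :
  [forall E in [set E : {set V} |
      (#|E| == 2) && [forall x in E, forall y in E, (x != y) ==> e x y]],
    #|E| == 2].
Proof. by apply/forall_inP => E; rewrite inE => /andP[]. Qed.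

Definition rel_graph (e : rel V) : sgraph V := SGraph (rel_graph_subproof e).

Lemma adj_rel_graph (e : rel V) :
  symmetric e -> irreflexive e -> adj (rel_graph e) =2 e.
Proof.
move=> sym_e irr_e x y; rewrite /adj inE cards2.
have [->|neq_xy] := eqVneq x y; first by rewrite irr_e.
apply/idP/idP => [/forall_inP/(_ x)|exy].
  rewrite !inE eqxx => /(_ isT)/forall_inP/(_ y).
  by rewrite !inE eqxx orbT neq_xy => /(_ isT).
apply/forall_inP => a /set2P[]->; apply/forall_inP => b /set2P[]->;
  by rewrite ?eqxx // ?(sym_e y) exy implybT.
Qed.

Definition clique G C : bool :=
  [forall x in C, forall y in C, (x != y) ==> adj G x y].

Lemma cliqueP G C :
  reflect {in C &, forall x y, x != y -> adj G x y} (clique G C).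
Proof.
apply: (iffP forall_inP) => [h x y xC yC neq_xy | h x xC].
  by move/forall_inP: (h x xC) => /(_ y yC); rewrite neq_xy.
by apply/forall_inP => y yC; apply/implyP; apply: h.
Qed.

(** Two distinct vertices of a clique with the same image would turn their edge into a loop, so [s]
    is injective on [C]. *)
Lemma clique_imset G G' (s : V -> V) C :
  (forall x y, adj G x y -> adj G' (s x) (s y)) ->
  clique G C -> clique G' (s @: C) /\ #|s @: C| = #|C|.
Proof.
move=> hom_s /cliqueP clC; split.
  apply/cliqueP => _ _ /imsetP[x xC ->] /imsetP[y yC ->] neq_s.
  by apply/hom_s/clC => //; apply: contraNneq neq_s => ->.
apply: card_in_imset => x y xC yC eq_s; apply/eqP.
by apply/contraT => /(clC x y xC yC)/hom_s; rewrite eq_s adj_irr.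
Qed.

(** Alignment sees only vertex sets, so a copy of $K_{k+1}$ can be replaced by a clique on [k.+1]
    vertices. *)
Definition meets_clique k G S : bool :=
  [exists C : {set V}, [&& #|C| == k.+1, clique G C & (S \subset C) || (C \subset S)]].

Lemma meets_clique_imset k G G' (s : V -> V) S :
  meets_clique k G S -> (forall x y, adj G x y -> adj G' (s x) (s y)) ->
  meets_clique k G' (s @: S).
Proof.
move=> /existsP[C /and3P[/eqP cardC clC alC]] hom_s.
have [clsC cardsC] := clique_imset hom_s clC.
apply/existsP; exists (s @: C); rewrite cardsC cardC eqxx clsC /=.
by case/orP: alC => sub; rewrite (imsetS s sub) ?orbT.
Qed.

End Basics.

(** * Copies as injective homomorphisms *)

Section Graphs.
Variable V : finType.
Implicit Types (G : sgraph V) (S C : {set V}) (u v x y : V).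
Implicit Types P : {set V} * {set {set V}}.

Lemma copiesP (W : finType) (H : sgraph W) G P :
  reflect (exists f : W -> V,
    [/\ injective f, P.1 = f @: [set: W],
        P.2 = [set f @: (e : {set W}) | e in edges H] &
        forall a b, adj H a b -> adj G (f a) (f b)])
    (P \in copies H G).
Proof.
rewrite inE; apply: (iffP andP).
  case=> /andP[/subsetP sPG _] /existsP[f /and3P[/injectiveP inj_f /eqP S_P /eqP E_P]].
  exists f; split=> [|||a b ab]; rewrite -?S_P -?E_P //.
  apply: sPG; rewrite -E_P; apply/imsetP; exists [set a; b] => //.
  by rewrite imsetU1 imset_set1.
case=> f [inj_f S_P E_P adj_f]; split.
  apply/andP; split.
    apply/subsetP => e; rewrite E_P => /imsetP[_ /edgeP[a [b [-> ab]]] ->].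
    by rewrite imsetU1 imset_set1; apply: adj_f.
  apply/forall_inP => e; rewrite E_P => /imsetP[e' _ ->].
  by rewrite S_P; apply: imsetS; apply/subsetP.
apply/existsP; exists (finfun f); apply/and3P; split.
- by apply/injectiveP => a b; rewrite !ffunE => /inj_f.
- by rewrite S_P; apply/eqP; apply: eq_imset => a; rewrite ffunE.
- by rewrite E_P; apply/eqP; apply: eq_imset => e; apply: eq_imset => a; rewrite ffunE.
Qed.

Lemma adj_complete_graph m (i j : 'I_m) : adj (complete_graph m) i j = (i != j).
Proof. by rewrite /adj inE cards2; case: (i == j). Qed.

Lemma align_clique k G (P : {set V} * {set {set V}}) :
  [exists Q in copies (complete_graph k.+1) G, align P Q] = meets_clique k G P.1.
Proof.
apply/exists_inP/existsP => [[Q /copiesP[f [inj_f S_Q _ adj_f]] alPQ]|].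
  exists Q.1; apply/and3P; split=> //.
    by rewrite S_Q card_imset // cardsT card_ord.
  apply/cliqueP => x y; rewrite S_Q => /imsetP[i _ ->] /imsetP[j _ ->].
  by rewrite (inj_eq inj_f) => ij; apply: adj_f; rewrite adj_complete_graph.
case=> C /and3P[/eqP cardC /cliqueP cliqueC alPC].
pose f (i : 'I_k.+1) : V := enum_val (cast_ord (esym cardC) i).
have inj_f : injective f by move=> i j /enum_val_inj /cast_ord_inj.
have f_C : C = f @: [set: 'I_k.+1].
  apply/esym/eqP; rewrite eqEcard card_imset // cardsT card_ord cardC leqnn andbT.
  by apply/subsetP => _ /imsetP[i _ ->]; apply: enum_valP.
exists (C, [set f @: (e : {set 'I_k.+1}) | e in edges (complete_graph k.+1)]) => //.
apply/copiesP; exists f; split=> // i j; rewrite adj_complete_graph => ij.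
by apply: cliqueC; rewrite ?(inj_eq inj_f) //; apply: enum_valP.
Qed.

(** * Good copies under Zykov symmetrization *)

Section Good.
Variables (W : finType) (H : sgraph W) (k : nat).

Definition good_copies G : {set {set V} * {set {set V}}} :=
  [set P in copies H G | ~~ meets_clique k G P.1].

Lemma N_reE G : N_re H (complete_graph k.+1) G = #|good_copies G|.
Proof.
by apply: eq_card => P; rewrite !inE align_clique.
Qed.

Lemma in_good_copies G P :
  (P \in good_copies G) = (P \in copies H G) && ~~ meets_clique k G P.1.
Proof. by rewrite in_set. Qed.

Lemma good_copies_involution (t : V -> V) G P : involutive t ->
  (forall x y, adj G (t x) (t y) = adj G x y) ->
  P \in good_copies G ->
  (t @: P.1, [set t @: (e : {set V}) | e in P.2]) \in good_copies G.
Proof.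
move=> tK tG; rewrite !in_good_copies => /andP[/copiesP[f [inj_f S_P E_P adj_f]] badP].
apply/andP; split.
  apply/copiesP; exists (t \o f); split=> /=.
  - exact: inj_comp (inv_inj tK) inj_f.
  - by rewrite S_P -imset_comp.
  - rewrite E_P -imset_comp; apply: eq_imset => e /=.
    by rewrite imset_comp.
  - by move=> a b /adj_f; rewrite tG.
(* Applying [t] again brings a clique aligned with the mirror image back to one aligned with [P]. *)
apply: contra badP => /(meets_clique_imset (s := t) (G' := G)) /=.
rewrite -imset_comp (eq_imset (g := id)) => [|x]; last by rewrite /= tK.
by rewrite imset_id; apply=> x y; rewrite tG.
Qed.

Section Twin.
Variables (G : sgraph V) (u v : V).
Hypothesis non_adj_uv : ~~ adj G u v.

Let s x := if x == u then v else x.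

(** The pullback of [G] along [s]: [u] receives the neighbours of [v], and [s] becomes a
    homomorphism from the new graph to [G]. *)
Definition make_twin : sgraph V := rel_graph (fun x y => adj G (s x) (s y)).

Lemma adj_make_twin x y : adj make_twin x y = adj G (s x) (s y).
Proof.
apply: (@adj_rel_graph V (fun x y => adj G (s x) (s y))) => [a b|a].
  exact: adj_sym.
exact: adj_irr.
Qed.

Lemma imset_make_twin S : u \notin S -> s @: S = S.
Proof.
move=> uS; rewrite -[RHS]imset_id; apply: eq_in_imset => x xS.
by rewrite /s; case: eqP xS uS => // -> ->.
Qed.

(** Adjacency away from [u] is unchanged, and [s] carries an aligned clique of the new graph to one
    of [G] while fixing [P.1]. *)
Lemma make_twin_notin P :
  u \notin P.1 -> P \in good_copies G -> P \in good_copies make_twin.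
Proof.
move=> uP; rewrite !in_good_copies => /andP[/copiesP[f [inj_f S_P E_P adj_f]] badP].
apply/andP; split.
  apply/copiesP; exists f; split=> // a b ab; rewrite adj_make_twin /s.
  have fu c : f c != u by apply: contraNneq uP => <-; rewrite S_P imset_f.
  by rewrite !(negPf (fu _)) adj_f.
apply: contra badP => /(meets_clique_imset (s := s) (G' := G)).
by rewrite imset_make_twin //; apply=> x y; rewrite adj_make_twin.
Qed.

Lemma make_twin_both P : complete_multipartite H ->
  u \in P.1 -> v \in P.1 -> u != v ->
  P \in good_copies G -> P \in good_copies make_twin.
Proof.
move=> [r [c part_c]] uP vP neq_uv.
rewrite !in_good_copies => /andP[/copiesP[f [inj_f S_P E_P adj_f]] badP].
have hom_s x y : adj make_twin x y -> adj G (s x) (s y) by rewrite adj_make_twin.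
have s_uv : s u = s v by rewrite /s eqxx if_same.
apply/andP; split.
  apply/copiesP; exists f; split=> // a b; rewrite adj_make_twin.
  move: uP vP; rewrite S_P => /imsetP[i _ u_i] /imsetP[j _ v_j].
  (* Preimages of nonadjacent vertices are nonadjacent, hence in one part of [H]; replacing [i] by
     [j] therefore preserves adjacency in [H]. *)
  have cij : c i = c j.
    apply/eqP; apply: contraNT non_adj_uv; rewrite -part_c u_i v_j; exact: adj_f.
  have s_f d : s (f d) = f (if d == i then j else d).
    by rewrite /s u_i (inj_eq inj_f) v_j; case: ifP.
  have c_s d : c (if d == i then j else d) = c d by case: eqP => // ->.
  by rewrite !s_f => ab; apply: adj_f; rewrite part_c !c_s -part_c.
apply: contra badP => /existsP[C /and3P[/eqP cardC clC alC]].
have [clsC cardsC] := clique_imset hom_s clC.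
apply/existsP; exists (s @: C); rewrite cardsC cardC eqxx clsC /=.
(* No clique of the new graph contains the twins [u] and [v], so none contains [P.1]; a clique
   inside [P.1] stays inside under [s], because [v] lies there. *)
case/orP: alC => /subsetP sPC.
  have := cliqueP _ _ clC u v (sPC u uP) (sPC v vP) neq_uv.
  by rewrite adj_make_twin s_uv adj_irr.
apply/orP; right; apply/subsetP => _ /imsetP[x /sPC xP ->].
by rewrite /s; case: ifP.
Qed.

(** All good copies outside [Au] survive. The mirror images of [Av] are good too, and contain [u]
    but not [v], hence differ from the survivors. *)
Lemma card_good_copies_make_twin : complete_multipartite H -> u != v ->
  #|good_copies G| + #|[set P in good_copies G | (v \in P.1) && (u \notin P.1)]|
  <= #|good_copies make_twin|
     + #|[set P in good_copies G | (u \in P.1) && (v \notin P.1)]|.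
Proof.
move=> multH neq_uv.
set A := good_copies G; set A' := good_copies make_twin.
set Av := [set P in A | _]; set Au := [set P in A | _].
(* The transposition of [u] and [v] is an automorphism of the new graph, as [s (t x) = s x]. *)
pose t x := if x == u then v else if x == v then u else x.
have tu : t u = v by rewrite /t eqxx.
have tv : t v = u by rewrite /t eqxx eq_sym (negPf neq_uv).
have tK : involutive t.
  move=> x; rewrite {2}/t; case: eqP => [->//|xu]; case: eqP => [->//|xv].
  by rewrite /t; do 2?case: eqP.
pose m P : {set V} * {set {set V}} :=
  (t @: P.1, [set t @: (e : {set V}) | e in P.2]).
have tt (S : {set V}) : t @: (t @: S) = S.
  rewrite -imset_comp -[RHS]imset_id; apply: eq_imset => x; exact: tK.
have mK : involutive m.
  case=> S E; rewrite /m /= tt; congr pair.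
  rewrite -imset_comp -[RHS]imset_id; apply: eq_imset => e; exact: tt.
have s_t x : s (t x) = s x.
  rewrite /t; have [->|xu] := eqVneq x u; first by rewrite /s eqxx if_same.
  by have [->|//] := eqVneq x v; rewrite /s eqxx if_same.
have t_twin x y : adj make_twin (t x) (t y) = adj make_twin x y.
  by rewrite !adj_make_twin !s_t.
have sub1 : A :\: Au \subset A'.
  apply/subsetP => P; rewrite inE in_set => /andP[+ PA]; rewrite PA /=.
  have [uP /negPn vP|uP _] := boolP (u \in P.1).
    exact: make_twin_both.
  exact: make_twin_notin.
have sub2 : m @: Av \subset A'.
  apply/subsetP => Q /imsetP[P + ->]; rewrite in_set => /and3P[PA vP uP].
  exact/good_copies_involution/make_twin_notin.
have dis : [disjoint A :\: Au & m @: Av].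
  rewrite disjoint_sym disjoints_subset; apply/subsetP => Q /imsetP[P + ->].
  rewrite in_set => /and3P[PA vP uP]; rewrite inE inE in_set.
  have -> : u \in (m P).1 by rewrite -tv imset_f.
  have -> : v \notin (m P).1.
    by rewrite -tu (mem_imset _ _ (inv_inj tK)).
  by rewrite !andbT andNb.
have /subset_leq_card : (A :\: Au) :|: m @: Av \subset A' by rewrite subUset sub1.
move: dis; rewrite -leq_card_setU => /eqP->.
rewrite (card_imset _ (inv_inj mK)) => le.
have sAu : Au \subset A by apply/subsetP => P; rewrite in_set => /andP[].
by rewrite -(cardsID Au A) (setIidPr sAu) -addnA addnC leq_add2r.
Qed.

End Twin.

Definition extremal G := forall G', #|good_copies G'| <= #|good_copies G|.

(** By extremality, the inequality for the step moving [v] to [u] shows that at least as many good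
    copies contain only [v] as contain only [u]. The inequality for the opposite step then shows
    that nothing is lost. *)
Lemma extremal_make_twin G u v : complete_multipartite H -> u != v ->
  ~~ adj G u v -> extremal G -> extremal (make_twin G u v).
Proof.
move=> multH neq_uv nadj exG G'.
apply: leq_trans (exG G') _.
have := card_good_copies_make_twin nadj multH neq_uv.
have nadj' : ~~ adj G v u by rewrite adj_sym.
have := card_good_copies_make_twin nadj' multH; rewrite eq_sym => /(_ neq_uv).
have := exG (make_twin G v u); lia.
Qed.

End Good.

(** * Twin classes and the second maximization *)

Definition twins G : rel V := fun x y => [forall z, adj G x z == adj G y z].

Lemma twinsP G x y : reflect (adj G x =1 adj G y) (twins G x y).
Proof. exact: 'forall_eqP. Qed.

Lemma twins_sym G : symmetric (twins G).
Proof. by move=> x y; apply/twinsP/twinsP => h z; rewrite h. Qed.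

Definition twin_pairs G : {set V * V} := [set p | twins G p.1 p.2].

(** Counting ordered pairs, [u] gains two for each member of the class of [v], and loses at most two
    for each member of its own class other than itself; that exclusion gives strictness. *)
Lemma twin_pairs_make_twin G u v :
  ~~ twins G u v -> #|twins G u| <= #|twins G v| ->
  #|twin_pairs G| < #|twin_pairs (make_twin G u v)|.
Proof.
move=> ntw le_uv; set G' := make_twin G u v.
pose cl x := [set y | twins G x y].
have card_cl x : #|twins G x| = #|cl x| by rewrite cardsE.
have twuu : u \in cl u by rewrite inE; apply/twinsP.
pose X w (S : {set V}) := setX [set w] S :|: setX S [set w].
have u_v : u \notin cl v by rewrite inE twins_sym.
have subB : X u (cl v) \subset twin_pairs G' :\: twin_pairs G.
  have tw' y : y \in cl v -> twins G' u y.
    move=> yv; apply/twinsP => z; rewrite !adj_make_twin eqxx.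
    have -> : (y == u) = false by apply: contraNF u_v => /eqP <-.
    by move: yv; rewrite inE => /twinsP.
  have ntw' y : y \in cl v -> ~~ twins G u y.
    rewrite inE => /twinsP vy; apply: contra ntw => /twinsP uy.
    by apply/twinsP => z; rewrite vy.
  apply/subsetP => -[x y]; rewrite in_setU !in_setX !in_set1 in_setD /=.
  rewrite ![(_, _) \in twin_pairs _]inE /=.
  case/orP=> /andP[].
    by move=> /eqP-> yv; rewrite tw' // ntw'.
  by move=> xv /eqP->; rewrite twins_sym [twins G' _ _]twins_sym tw' // ntw'.
have subA : twin_pairs G :\: twin_pairs G' \subset X u (cl u :\ u).
  apply/subsetP => -[x y]; rewrite in_setU !in_setX !in_set1 in_setD /=.
  rewrite ![(_, _) \in twin_pairs _]inE !in_setD1 !inE /= => /andP[ntw' tw].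
  have [def_x|xu] := eqVneq x u.
    have [def_y|yu] := eqVneq y u.
      by case/negP: ntw'; rewrite def_x def_y; apply/twinsP.
    by rewrite -def_x tw.
  have [def_y|yu] := eqVneq y u; first by rewrite -def_y twins_sym tw.
  (* Neighbourhoods of vertices other than [u] are pulled back along [s], so equal ones stay
     equal. *)
  case/negP: ntw'; apply/twinsP => z; rewrite !adj_make_twin.
  by rewrite (negPf xu) (negPf yu); move/twinsP: tw.
have cardB : #|X u (cl v)| = #|cl v| + #|cl v|.
  rewrite /X cardsU !cardsX cards1 mul1n muln1.
  have -> : setX [set u] (cl v) :&: setX (cl v) [set u] = set0.
    apply/setP => -[x y]; rewrite in_setI !in_setX !in_set1 in_set0 /=.
    apply/negP => /andP[/andP[/eqP-> _] /andP[uv _]].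
    by rewrite uv in u_v.
  by rewrite cards0 subn0.
have cardA : #|X u (cl u :\ u)| <= #|cl u :\ u| + #|cl u :\ u|.
  by rewrite /X cardsU !cardsX cards1 mul1n muln1 leq_subr.
have lt_cl : #|cl u :\ u| < #|cl v|.
  by rewrite -card_cl (leq_trans _ le_uv) // card_cl (cardsD1 u (cl u)) twuu.
rewrite -(cardsID (twin_pairs G') (twin_pairs G)).
rewrite -(cardsID (twin_pairs G) (twin_pairs G')) setIC ltn_add2l.
apply: leq_ltn_trans (subset_leq_card subA) _.
apply: leq_trans (subset_leq_card subB); rewrite cardB.
by apply: leq_ltn_trans cardA _; rewrite -addSn leq_add // ltnW.
Qed.

Lemma exists_extremal_twins (W : finType) (H : sgraph W) k :
  complete_multipartite H ->
  exists G, extremal H k G /\ forall x y, ~~ adj G x y -> twins G x y.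
Proof.
move=> multH.
pose ex G := [forall G', #|good_copies H k G'| <= #|good_copies H k G|].
have exP G : reflect (extremal H k G) (ex G) by exact: forallP.
(* The edgeless graph is the default value for the [arg max]. *)
pose G0 := rel_graph (fun _ _ : V => false).
pose G1 := [arg max_(G > G0) #|good_copies H k G|].
have ex1 : ex G1.
  by apply/exP => G; rewrite /G1; case: arg_maxnP => // G2 _; apply.
case: (arg_maxnP (fun G => #|twin_pairs G|) ex1) => G /exP exG maxG.
exists G; split=> // x y; have [-> _|neq_xy] := eqVneq x y; first exact/twinsP.
have noninc u v : u != v -> ~~ adj G u v -> #|twins G u| <= #|twins G v| ->
    twins G u v.
  move=> neq_uv nadj le_uv; apply: contraT => ntw.
  have := twin_pairs_make_twin ntw le_uv; rewrite ltnNge => /negP[].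
  exact/maxG/exP/extremal_make_twin.
(* The vertex whose class is not the larger one is the one to move. *)
move=> nadj; have [|/ltnW le_yx] := leqP #|twins G x| #|twins G y|.
  exact: noninc.
by rewrite twins_sym; apply: noninc; rewrite // 1?eq_sym 1?adj_sym.
Qed.

(** * From twin classes to complete partite graphs *)

Lemma surjective_coloring G :
  (forall x y, ~~ adj G x y -> twins G x y) ->
  exists (r : nat) (c : V -> 'I_r),
    complete_partite G c /\ forall i, exists x, c x = i.
Proof.
(* The colour of a vertex is its neighbourhood, among those that occur; so every colour is used. *)
move=> twG; pose N x := [set z | adj G x z]; pose A := N @: [set: V].
have NA x : N x \in A by apply: imset_f.
exists #|A|, (fun x => enum_rank_in (NA x) (N x)); split=> [x y | i].
  apply/idP/idP => [xy|]; last first.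
    apply: contraNT => /twG/twinsP eq_xy; rewrite -(inj_eq enum_val_inj).
    by rewrite !enum_rankK_in //; apply/eqP/setP => z; rewrite !inE.
  apply: contraTneq xy => /(congr1 enum_val); rewrite !enum_rankK_in //.
  by move=> /setP/(_ y); rewrite !inE adj_irr => ->.
have /imsetP[x _ def_i] := enum_valP i.
by exists x; apply: enum_val_inj; rewrite enum_rankK_in.
Qed.

Lemma refine_coloring (r k : nat) (c : V -> 'I_r) :
  r <= k <= #|V| -> (forall i, exists x, c x = i) ->
  exists d : V -> 'I_k,
    (forall i, exists x, d x = i) /\ forall x y, c x != c y -> d x != d y.
Proof.
move=> + surj_c; elim: k => [|k IHk] /andP[le_rk le_kV].
  by move: le_rk; rewrite leqn0 => /eqP r0; subst r; exists c.
have [r_k1|] := eqVneq r k.+1; first by subst r; exists c.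
rewrite neq_ltn ltnS [k.+1 < r]ltnNge le_rk orbF => {}le_rk.
have [|d [surj_d ref_d]] := IHk; first by rewrite le_rk ltnW.
(* Fewer colours than vertices: some [x] and [y] share a colour. Then [x] takes the new colour,
   while [y] keeps the old one in use. *)
have /injectivePn[x [y neq_yx d_xy]] : ~~ injectiveb d.
  by apply/injectiveP => /leq_card; rewrite card_ord leqNgt le_kV.
pose d' z := if z == x then ord_max else widen_ord (leqnSn k) (d z).
exists d'; split=> [i|a b /ref_d].
  have [->|] := eqVneq i ord_max; first by exists x; rewrite /d' eqxx.
  case: (unliftP ord_max i) => [j -> _|-> /eqP//].
  have [z def_j] := surj_d j.
  have [z_x|z_x] := eqVneq z x.
    exists y; rewrite /d' eq_sym (negPf neq_yx); apply: val_inj.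
    by rewrite [RHS]lift_max /= -d_xy -z_x def_j.
  by exists z; rewrite /d' (negPf z_x); apply: val_inj; rewrite [RHS]lift_max /= def_j.
rewrite /d'; have ltd z : val (d z) != k by rewrite neq_ltn ltn_ord.
move=> d_ab; case: (eqVneq a x) d_ab => [->|_]; case: (eqVneq b x) => [->|_];
  by rewrite -!val_eqE /= ?eqxx //= => ne; rewrite ?ne ?ltd // eq_sym ltd.
Qed.

(** The larger graph is [k]-colourable, so by pigeonhole it has no $K_{k+1}$ and all its copies of
    [H] are good. *)
Lemma leq_good_copies (W : finType) (H : sgraph W) (k : nat) G (d : V -> 'I_k) :
  (forall x y, adj G x y -> d x != d y) ->
  #|good_copies H k G| <= #|good_copies H k (rel_graph (fun x y => d x != d y))|.
Proof.
set G' := rel_graph _ => adjG.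
have adjG' x y : adj G' x y = (d x != d y).
  by apply: (@adj_rel_graph V (fun x y => d x != d y)) => [a b|a];
    rewrite ?eqxx 1?eq_sym.
apply/subset_leq_card/subsetP => P; rewrite !in_good_copies.
case/andP=> /copiesP[f [inj_f S_P E_P adj_f]] _; apply/andP; split.
  by apply/copiesP; exists f; split=> // a b /adj_f/adjG; rewrite adjG'.
apply/negP => /existsP[C /and3P[/eqP cardC /cliqueP clC _]].
have : #|d @: C| <= k by rewrite -[leqRHS]card_ord max_card.
rewrite card_in_imset ?cardC ?ltnn // => x y xC yC d_xy.
by apply/eqP; apply: contraT => /(clC x y xC yC); rewrite adjG' d_xy eqxx.
Qed.

End Graphs.

(** * Adjusting the number of parts of an extremal graph *)

Theorem theorem1p6 (W : finType) (K : sgraph W) (k : nat)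
  (hK : complete_multipartite K) (hk : 1 <= k) (n : nat) :
  exists (T : sgraph 'I_n) (r : nat) (c : 'I_n -> 'I_r),
    [/\ k <= r,
        complete_partite T c,
        k <= n -> forall i : 'I_r, exists x : 'I_n, c x = i &
        ex_re n K (complete_graph k.+1) = N_re K (complete_graph k.+1) T].
Proof.
have ex_reE (T : sgraph 'I_n) : extremal K k T ->
    ex_re n K (complete_graph k.+1) = N_re K (complete_graph k.+1) T.
  move=> exT; apply/eqP; rewrite eqn_leq leq_bigmax andbT.
  by apply/bigmax_leqP => G _; rewrite !N_reE.
have [T [exT twT]] := @exists_extremal_twins 'I_n W K k hK.
have [r [c [part_c surj_c]]] := surjective_coloring twT.
have [le_kr|lt_rk] := leqP k r.
  by exists T, r, c; split=> //; apply: ex_reE.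
have [le_kn|lt_nk] := leqP k n.
  have [|d [surj_d ref_d]] := @refine_coloring _ r k c _ surj_c.
    by rewrite card_ord ltnW.
  exists (rel_graph (fun x y => d x != d y)), k, d; split=> //.
    by move=> x y; apply: (@adj_rel_graph _ (fun x y => d x != d y)) => [a b|a];
      rewrite ?eqxx 1?eq_sym.
  apply: ex_reE => G; apply: leq_trans (exT G) (leq_good_copies _ _) => x y.
  by rewrite part_c => /ref_d.
(* For [n < k] the graph is kept and empty parts are added; the nonemptiness clause is vacuous. *)
exists T, k, (fun x => widen_ord (ltnW lt_rk) (c x)); split=> //.
exact: ex_reE.
Qed.
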